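(* Let $0<q<1$ and let $\{p_n(z;q)\}_{n\in\mathbb N_0}$ be an odd $q$-Lidstone polynomial sequence of type I with associated numerical sequence $(\alpha_{2n})_{n\ge 0}$, and let $\{\hat p_n(z;q)\}_{n\in\mathbb N_0}$ be its conjugate sequence. Then for every $n\in\mathbb N_0$ $$\hat p_n(z;q)= \frac{1}{\alpha_0}\Big[z^{2n+1}-\sum_{k=0}^{n-1} {2n+1 \brack 2k+1}_q\, \frac{\alpha_{2(n-k)}}{[2(n-k)+1]_q}\, \hat p_k(z;q)\Big].$$ Moreover $\hat p_0(z;q)=\frac1{\alpha_0}z$ and, for $n\ge1$, $$\hat p_n(z;q)=\frac{(-1)^n}{[3]_q!\,[5]_q!\cdots[2n-1]_q!\;\alpha_0^{\,n+1}}\;\det M_n,$$ where $M_n$ is the $(n+1)\times(n+1)$ matrix with columns indexed by $i=0,\dots,n$ whose first row has entries $z^{2i+1}$, whose second row has entries $\alpha_{2i}$, and whose $(k+2)$-nd row, for $k=1,\dots,n-1$, has entries $\frac{[2i+1]_q!}{[2(i-k)+1]_q!}\,\alpha_{2(i-k)}$ for $i\ge k$ and $0$ for $i<k$. (The product $[3]_q!\cdots[2n-1]_q!$ is $1$ for $n=1$.)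
   Context: Fix $0<q<1$. Put $[m]_q=\frac{1-q^m}{1-q}$, $[m]_q!=\prod_{j=1}^m[j]_q$, $[0]_q!=1$, and ${n \brack k}_q=\frac{[n]_q!}{[k]_q!\,[n-k]_q!}$ for $0\le k\le n$. $\mathbb N=\{1,2,\dots\}$, $\mathbb N_0=\mathbb N\cup\{0\}$. The Jackson $q$-derivative is $D_qf(z)=\frac{f(qz)-f(z)}{(q-1)z}$ for $z\ne0$ and $D_qf(0)=f'(0)$, so $D_qz^m=[m]_qz^{m-1}$. An odd $q$-Lidstone polynomial sequence of type I (class $q$OLS-I) is a sequence $\{p_n(z;q)\}_{n\in\mathbb N_0}$ of polynomials in $z$ with real coefficients such that $D_q^2p_n(z;q)=[2n+1]_q[2n]_q\,p_{n-1}(z;q)$ for $n\in\mathbb N$, $p_n(0;q)=0$ for $n\in\mathbb N_0$, and $p_0(z;q)=\alpha_0z$ with $\alpha_0\in\mathbb R\setminus\{0\}$. Its associated numerical sequence is $\alpha_{2n}:=D_qp_n(0;q)$, and $p_n(z;q)=\sum_{k=0}^n {2n+1 \brack 2k+1}_q\frac{\alpha_{2(n-k)}}{[2(n-k)+1]_q}z^{2k+1}$. The sequence $(\beta_{2n})_{n\ge0}$ is the unique real sequence with $\sum_{j=0}^n \frac{\beta_{2j}\,\alpha_{2(n-j)}}{[2j+1]_q!\,[2(n-j)+1]_q!}=\delta_{n0}$ for all $n\in\mathbb N_0$ (Kronecker delta). The conjugate sequence of $\{p_n\}_n$ is $\hat p_n(z;q)=\sum_{k=0}^n {2n+1 \brack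 2k+1}_q\frac{\beta_{2(n-k)}}{[2(n-k)+1]_q}z^{2k+1}$. Empty sums are $0$. *)

(* Defs.v *)
From HB Require Import structures.
From mathcomp Require Import all_boot all_order all_algebra.
From mathcomp Require Import all_classical all_reals all_analysis.

Set Implicit Arguments.
Unset Strict Implicit.
Unset Printing Implicit Defensive.

Import Order.TTheory GRing.Theory Num.Theory.
Import numFieldNormedType.Exports.
Local Open Scope ring_scope.

Definition qint (R : realType) (q : R) (m : nat) : R := (1 - q ^+ m) / (1 - q).

Definition qfact (R : realType) (q : R) (m : nat) : R :=
  \prod_(1 <= j < m.+1) qint q j.

(* Only meaningful for k <= n: for k > n the truncated n - k gives a junk,
   nonzero value. *)
Definition qbinom (R : realType) (q : R) (n k : nat) : R :=
  qfact q n / (qfact q k * qfact q (n - k)).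

Definition jackson (R : realType) (q : R) (f : R -> R) (z : R) : R :=
  if z == 0 then derive1 f 0 else (f (q * z) - f z) / ((q - 1) * z).

Definition qOLS1 (R : realType) (q : R) (p : nat -> {poly R}) : Prop :=
  [/\ forall n : nat, (0 < n)%N -> forall z : R,
        jackson q (jackson q (horner (p n))) z
        = qint q n.*2.+1 * qint q n.*2 * (p n.-1).[z],
      forall n : nat, (p n).[0] = 0
    & exists2 a : R, a != 0 & p 0%N = a *: 'X].

(* Every sequence below is indexed by half the subscript used on paper:
   [qOLS1_seq q p n] is alpha_{2n}, and [beta n] is beta_{2n}. *)
Definition qOLS1_seq (R : realType) (q : R) (p : nat -> {poly R}) (n : nat) : R :=
  jackson q (horner (p n)) 0.

Definition qconj_num_seq (R : realType) (q : R) (alpha beta : nat -> R) : Prop :=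
  forall n : nat,
    \sum_(j < n.+1) beta j * alpha (n - j)%N
                    / (qfact q j.*2.+1 * qfact q (n - j).*2.+1)
    = (n == 0%N)%:R.

Definition qconj_poly (R : realType) (q : R) (beta : nat -> R) (n : nat) : {poly R} :=
  \sum_(k < n.+1)
    (qbinom q n.*2.+1 k.*2.+1 * (beta (n - k)%N / qint q (n - k).*2.+1))
      *: 'X^(k.*2.+1).

(* Rows are numbered from 0 here, so row k.+1 with k >= 1 is the (k+2)-nd row. *)
Definition qconj_mx (R : realType) (q : R) (alpha : nat -> R) (n : nat)
    : 'M[{poly R}]_n.+1 :=
  \matrix_(r < n.+1, i < n.+1)
    match nat_of_ord r with
    | 0 => 'X^(i.*2.+1)
    | 1 => (alpha i)%:P
    | k.+1 =>
        if (k <= i)%N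
        then (qfact q i.*2.+1 / qfact q (i - k).*2.+1 * alpha (i - k)%N)%:P
        else 0
    end.

Lemma qint_gt0 (R : realType) (q : R) (m : nat) :
  0 < q -> q < 1 -> (0 < m)%N -> 0 < qint q m.
Proof.
move=> q0 q1 m0; rewrite divr_gt0 ?subr_gt0 //.
by rewrite exprn_ilt1 ?ltW // -lt0n.
Qed.

Lemma qfact_gt0 (R : realType) (q : R) (m : nat) :
  0 < q -> q < 1 -> 0 < qfact q m.
Proof.
move=> q0 q1; rewrite /qfact big_nat_cond; apply: prodr_gt0 => j.
by rewrite andbT => /andP[j0 _]; exact: qint_gt0.
Qed.

Lemma qconj_num_seq_exists_unique (R : realType) (q : R) (alpha : nat -> R) :
  0 < q -> q < 1 -> alpha 0%N != 0 -> exists! beta, qconj_num_seq q alpha beta.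
Proof.
move=> q0 q1 a0.
pose f m := qfact q m.*2.+1.
have f0 m : f m != 0 by rewrite gt_eqF ?qfact_gt0.
pose rest (s : nat -> R) n :=
  \sum_(j < n) s j * alpha (n - j)%N / (f j * f (n - j)%N).
pose next (s : nat -> R) (n : nat) := ((n == 0%N)%:R - rest s n) * (f n * f 0%N) / alpha 0%N.
have split_sum (s : nat -> R) (n : nat) :
    \sum_(j < n.+1) s j * alpha (n - j)%N
                    / (qfact q j.*2.+1 * qfact q (n - j).*2.+1)
    = rest s n + s n * alpha 0%N / (f n * f 0%N).
  by rewrite big_ord_recr /= subnn.
have ff0 n : f n * f 0%N != 0 by rewrite mulf_neq0.
have nextP (s : nat -> R) : qconj_num_seq q alpha s <-> forall n, s n = next s n.
  split=> H n.
    by rewrite /next -(H n) split_sum [rest s n + _]addrC addrK divfK ?mulfK.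
  by rewrite split_sum (H n) /next divfK // mulfK // addrC subrK.
have eq_next (s t : nat -> R) (n : nat) : (forall j, (j < n)%N -> s j = t j) -> next s n = next t n.
  move=> st; rewrite /next /rest.
  by congr ((_ - _) * _ / _); apply: eq_bigr => j _; rewrite st.
pose fix build n := if n is m.+1 then
  let s := build m in rcons s (next (nth 0 s) m) else [::].
have size_build n : size (build n) = n.
  by elim: n => //= n IH; rewrite size_rcons IH.
have nth_build n j : (j < n)%N -> nth 0 (build n) j = nth 0 (build j.+1) j.
  elim: n => // n IH; rewrite ltnS leq_eqVlt => /predU1P[->//|jn].
  by rewrite [build n.+1]/= nth_rcons size_build jn IH.
exists (fun n => nth 0 (build n.+1) n); split.
  apply/nextP => n; rewrite /= nth_rcons size_build ltnn eqxx.
  by apply: eq_next => j jn; rewrite nth_build.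
move=> t /nextP Ht; apply/funext => n.
elim/ltn_ind: n => n IH; rewrite Ht /= nth_rcons size_build ltnn eqxx.
by apply: eq_next => j jn; rewrite -IH // nth_build.
Qed.

(* Main.v *)
(* Divide each sequence by [2n+1]_q!: the sums involved become Cauchy
   convolutions. Encode a sequence [a] by its upper triangular Toeplitz matrix
   T(a), so that T(a) T(b) = T(a * b). The hypothesis on beta says that T(beta)
   is the inverse of T(alpha), and the definition of the conjugate sequence says
   that the row (phat_j) is (z^(2j+1)) T(beta). Multiplying by T(alpha) gives the
   recurrence. For the determinant, pull the column factors [2i+1]_q! out of M_n
   and multiply on the right by T(beta), whose determinant is alpha_0^-(n+1): the
   first row becomes (phat_j) and the others become the first n rows of the
   identity, so only the upper right entry phat_n contributes. *)
Require Import Defs.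
From HB Require Import structures.
From mathcomp Require Import all_boot all_order all_algebra.
From mathcomp Require Import ring.
From mathcomp Require Import all_classical all_reals all_analysis.

Set Implicit Arguments.
Unset Strict Implicit.
Unset Printing Implicit Defensive.

Import Order.TTheory GRing.Theory Num.Theory.
Local Open Scope ring_scope.

Definition toeplitz (S : comNzRingType) (m : nat) (a : nat -> S) : 'M[S]_m :=
  \matrix_(i < m, j < m) if (i <= j)%N then a (j - i)%N else 0.

(** In entry (i, j) only the indices between [i] and [j] survive; shifting them by [i] turns the sum
    into the convolution at [j - i]. *)
Lemma mul_toeplitz (S : comNzRingType) (m : nat) (a b : nat -> S) :
  toeplitz m a *m toeplitz m b
  = toeplitz m (fun n => \sum_(k < n.+1) a k * b (n - k)%N).
Proof.
apply/matrixP => i j; rewrite !mxE.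
under eq_bigr do rewrite !mxE.
case: leqP => [le_ij|lt_ji]; last first.
  apply: big1 => k _; case: leqP => [le_ik|_]; last by rewrite mul0r.
  by rewrite leqNgt (leq_trans lt_ji le_ik) mulr0.
rewrite -(big_mkord xpredT (fun k =>
  (if (i <= k)%N then a (k - i)%N else 0) *
  (if (k <= j)%N then b (j - k)%N else 0))) /=.
rewrite (big_cat_nat (n := i)) ?(ltnW (ltn_ord i)) //=.
rewrite big_nat_cond big1 ?add0r; last first.
  by move=> k /andP[/andP[_ lt_ki] _]; rewrite leqNgt lt_ki mul0r.
rewrite (big_cat_nat (n := j.+1)) ?(leqW le_ij) //=.
rewrite [X in _ + X]big_nat_cond [X in _ + X]big1 ?addr0; last first.
  by move=> k /andP[/andP[lt_jk _] _]; rewrite [(k <= j)%N]leqNgt lt_jk mulr0.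
rewrite -{1}[nat_of_ord i]add0n big_addn subSn // big_mkord.
apply: eq_bigr => k _.
have le_kij : (k + i <= j)%N by rewrite addnC -leq_subRL // -ltnS.
by rewrite leq_addl addnK le_kij addnC subnDA.
Qed.

Lemma row_mul_toeplitz (S : comNzRingType) (m : nat) (c x : nat -> S) (j : 'I_m) :
  \sum_(i < m) x i * toeplitz m c i j = \sum_(k < j.+1) x k * c (j - k)%N.
Proof.
rewrite (big_ord_widen_cond m xpredT (fun k => x k * c (j - k)%N)) //=.
rewrite [RHS]big_mkcond /=; apply: eq_bigr => i _; rewrite mxE ltnS.
by case: leqP; rewrite ?mulr0.
Qed.

Lemma det_toeplitz (S : comNzRingType) (m : nat) (c : nat -> S) :
  \det (toeplitz m c) = c 0%N ^+ m.
Proof.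
rewrite -det_tr det_trig.
  rewrite -[m in RHS]card_ord -prodr_const.
  by apply: eq_bigr => i _; rewrite !mxE leqnn subnn.
by apply/is_trig_mxP => i j lt_ij; rewrite !mxE leqNgt lt_ij.
Qed.

Section ConvolutionInverse.
Variables (S : comNzRingType) (a b : nat -> S).
Hypothesis conv_ba :
  forall n, \sum_(k < n.+1) b k * a (n - k)%N = (n == 0%N)%:R.

Lemma toeplitz_inverse (m : nat) : toeplitz m b *m toeplitz m a = 1%:M.
Proof.
rewrite mul_toeplitz; apply/matrixP => i j; rewrite !mxE conv_ba subn_eq0.
by rewrite -val_eqE /= eqn_leq; case: leqP.
Qed.

(** At size [n.+1] the hypothesis reads X T(b) = Y; multiplying by T(a) gives Y T(a) = X, whose last
    entry is the claim. *)
Lemma conv_inverse (x y : nat -> S) :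
  (forall n, y n = \sum_(k < n.+1) x k * b (n - k)%N) ->
  forall n, \sum_(k < n.+1) y k * a (n - k)%N = x n.
Proof.
move=> def_y n; pose X := \row_(i < n.+1) x i.
have defY : X *m toeplitz n.+1 b = \row_(j < n.+1) y j.
  apply/rowP => j; rewrite !mxE def_y -row_mul_toeplitz.
  by apply: eq_bigr => i _; rewrite !mxE.
have := congr1 (fun A : 'rV_n.+1 => A 0 ord_max) (mulmxA X (toeplitz _ b) (toeplitz _ a)).
rewrite toeplitz_inverse mulmx1 defY !mxE => def_x.
rewrite -[RHS]/(x (@ord_max n)) def_x -(row_mul_toeplitz a y (@ord_max n)).
by apply: eq_bigr => i _; rewrite !mxE.
Qed.

Lemma det_bordered_toeplitz (n : nat) (x : nat -> S) :
  \det (\matrix_(r < n.+1, i < n.+1)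
          if nat_of_ord r is k.+1 then (if (k <= i)%N then a (i - k)%N else 0)
          else x i) * b 0%N ^+ n.+1
  = (-1) ^+ n * \sum_(k < n.+1) x k * b (n - k)%N.
Proof.
set N := \matrix_(r, i) _; rewrite -det_toeplitz -det_mulmx.
have NT_S (k : 'I_n) j : (N *m toeplitz n.+1 b) (lift ord0 k) j = (k == j :> nat)%:R.
  (* Row [k.+1] of [N] is row [k] of T(a), and T(a) T(b) = 1 as well, square inverses being
     two-sided. *)
  have /matrixP/(_ (widen_ord (leqnSn n) k) j) := mulmx1C (toeplitz_inverse n.+1).
  rewrite !mxE => <-; apply: eq_bigr => i _.
  by rewrite !mxE.
rewrite (expand_det_col _ ord_max) big_ord_recl big1 ?addr0; last first.
  by move=> k _; rewrite NT_S /= ltn_eqF ?mul0r.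
rewrite mxE -(row_mul_toeplitz b x ord_max) mulrC; congr (_ * _); last first.
  by apply: eq_bigr => i _; rewrite !mxE.
(* Deleting the first row and the last column leaves the identity, so the cofactor is just the sign
   (-1)^n. *)
rewrite /cofactor add0n [X in \det X](_ : _ = 1%:M) ?det1 ?mulr1 //.
apply/matrixP => k j; rewrite [LHS]mxE [LHS]mxE NT_S [RHS]mxE.
by rewrite lift_max.
Qed.

End ConvolutionInverse.

(** The divisor [2(n-k)+1]_q completes [2(n-k)]_q! to the next factorial, so that all weights become
    those of a Cauchy convolution. *)
Lemma qbinom_odd_div (R : realType) (q : R) (n k : nat) (c : R) :
  0 < q -> q < 1 -> (k <= n)%N ->
  qbinom q n.*2.+1 k.*2.+1 * (c / qint q (n - k).*2.+1)
  = qfact q n.*2.+1 * ((qfact q k.*2.+1)^-1 * (c / qfact q (n - k).*2.+1)).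
Proof.
move=> q0 q1 le_kn; rewrite /qbinom subSS -doubleB.
rewrite [qfact q (n - k).*2.+1]/qfact big_nat_recr //= -/(qfact q _).
by rewrite !invfM; ring.
Qed.

Theorem theorem2p18 (R : realType) (q : R) (hq0 : 0 < q) (hq1 : q < 1)
    (p : nat -> {poly R}) (hp : qOLS1 q p)
    (alpha : nat -> R) (halpha : forall n : nat, alpha n = qOLS1_seq q p n)
    (beta : nat -> R) (hbeta : qconj_num_seq q alpha beta)
    (phat : nat -> {poly R}) (hphat : forall n : nat, phat n = qconj_poly q beta n) :
  (forall n : nat,
     phat n = (alpha 0%N)^-1 *:
       ('X^(n.*2.+1)
        - \sum_(k < n)
            (qbinom q n.*2.+1 k.*2.+1
             * (alpha (n - k)%N / qint q (n - k).*2.+1)) *: phat k))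
  /\ phat 0%N = (alpha 0%N)^-1 *: 'X
  /\ (forall n : nat, (1 <= n)%N ->
        phat n =
          ((-1) ^+ n
           / ((\prod_(1 <= j < n) qfact q j.*2.+1) * alpha 0%N ^+ n.+1))
          *: \det (qconj_mx q alpha n)).
Proof.
pose f m := qfact q m.*2.+1.
have f_neq0 m : f m != 0 by rewrite gt_eqF ?qfact_gt0.
have f0 : f 0%N = 1 by rewrite /f /qfact big_nat1 /qint expr1 divff // subr_eq0 gt_eqF.
pose a n : {poly R} := (alpha n / f n)%:P.
pose b n : {poly R} := (beta n / f n)%:P.
pose x n : {poly R} := (f n)^-1 *: 'X^(n.*2.+1).
pose y n : {poly R} := (f n)^-1 *: phat n.
have conv_ba n : \sum_(k < n.+1) b k * a (n - k)%N = (n == 0%N)%:R.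
  rewrite -[RHS]polyC_natr -hbeta rmorph_sum; apply: eq_bigr => k _.
  by rewrite -polyCM mulf_div.
have def_y n : y n = \sum_(k < n.+1) x k * b (n - k)%N.
  rewrite /y hphat /qconj_poly scaler_sumr; apply: eq_bigr => k _.
  rewrite qbinom_odd_div ?leq_ord // scalerA mulKf //.
  by rewrite -scalerAl [_ * (b _)]mulrC mul_polyC scalerA.
have beta0 : beta 0%N * alpha 0%N = 1.
  by have := hbeta 0%N; rewrite big_ord1 subnn -/(f 0%N) f0 mulr1 divr1.
have alpha0 : alpha 0%N != 0.
  by apply/eqP => a0; move/eqP: beta0; rewrite a0 mulr0 eq_sym oner_eq0.
have phat_y n : phat n = f n *: y n by rewrite /y scalerA mulfV ?scale1r.
have recurrence n : phat n = (alpha 0%N)^-1 *: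
    ('X^(n.*2.+1) - \sum_(k < n) (qbinom q n.*2.+1 k.*2.+1
       * (alpha (n - k)%N / qint q (n - k).*2.+1)) *: phat k).
  have := conv_inverse conv_ba def_y n.
  (* The term k = n, which contains [phat n], is isolated and the identity is scaled back by
     [f n]. *)
  rewrite big_ord_recr /= subnn => /(congr1 ( *:%R (f n))).
  rewrite [RHS]scalerA mulfV // scale1r => <-.
  rewrite [f n *: (_ + _)]scalerDr scaler_sumr.
  have -> : \sum_(k < n) f n *: (y k * a (n - k)%N) =
     \sum_(k < n) (qbinom q n.*2.+1 k.*2.+1
       * (alpha (n - k)%N / qint q (n - k).*2.+1)) *: phat k.
    apply: eq_bigr => k _; rewrite qbinom_odd_div 1?ltnW // [y k * _]mulrC mul_polyC.
    by rewrite /y /f !scalerA; congr (_ *: _); ring.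
  rewrite addrAC subrr add0r [y n * _]mulrC mul_polyC f0 divr1.
  by rewrite [f n *: _]scalerA [f n * _]mulrC -scalerA -phat_y scalerA mulVf ?scale1r.
split=> [//|]; split=> [|n n_gt0].
  by rewrite recurrence big_ord0 subr0 expr1.
(* The row of the [alpha i] is the shift by 0, so all rows below the first follow a single Toeplitz
   pattern. *)
have defM : qconj_mx q alpha n = (\matrix_(r < n.+1, i < n.+1)
    if nat_of_ord r is k.+1 then (if (k <= i)%N then a (i - k)%N else 0)
    else x i) *m diag_mx (\row_i (f i)%:P).
  apply/matrixP => r i; rewrite mul_mx_diag !mxE.
  case: (nat_of_ord r) => [|[|k]].
  - by rewrite mulrC mul_polyC scalerA mulfV ?scale1r.
  - by rewrite subn0 -polyCM divfK.
  case: ifP => _; last by rewrite mul0r.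
  by rewrite -polyCM -/(f i) -/(f _); congr _%:P; ring.
have := det_bordered_toeplitz conv_ba n x.
rewrite -def_y defM det_mulmx det_diag.
set D := \det _ => detD.
(* The factor [f 0] is 1, and [f n] is split off to match the one in [phat n = f n *: y n]; hence
   the product in the theorem stops at [2n-1]_q!. *)
have prodf : \prod_(i < n.+1) (\row_(i < n.+1) (f i)%:P) 0 i
   = ((\prod_(1 <= j < n) f j) * f n)%:P.
  under [LHS]eq_bigr do rewrite mxE.
  rewrite -rmorph_prod -(big_mkord xpredT f) big_nat_recr //= big_ltn // f0.
  by rewrite mul1r.
have b0 : b 0%N = ((alpha 0%N)^-1)%:P.
  by rewrite /b f0 divr1; congr _%:P; rewrite -[RHS]mul1r -beta0 mulfK.
have Dy : D = (alpha 0%N ^+ n.+1 * (-1) ^+ n) *: y n.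
  rewrite -scalerA -[(-1) ^+ n *: _]mul_polyC rmorphXn rmorphN1 -detD b0.
  rewrite -rmorphXn [D * _]mulrC mul_polyC scalerA exprVn mulfV ?scale1r //.
  by rewrite expf_neq0.
rewrite prodf [D * _]mulrC mul_polyC Dy phat_y.
move: (y n) => yn; rewrite !scalerA; congr (_ *: _).
(* One sign comes from the prefactor, the other from the cofactor. *)
have sgn : (-1) ^+ n * (-1) ^+ n = 1 :> R by rewrite -expr2 sqrr_sign.
have prod_neq0 : \prod_(1 <= j < n) f j != 0.
  by rewrite prodf_seq_neq0; apply/allP => j _; rewrite f_neq0 implybT.
have : alpha 0%N ^+ n.+1 != 0 by rewrite expf_neq0.
move: sgn prod_neq0; rewrite -/f.
set s := (-1) ^+ n; set P := \prod_(1 <= j < n) f j; set A := alpha 0%N ^+ _.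
move: s P A (f n) => s P A fn ss P_neq0 A_neq0.
by rewrite -[LHS]mul1r -ss; field; rewrite P_neq0 A_neq0.
Qed.
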